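(* Let $(a_{ij})_{(i,j)\in\mathbb{N}^2}$ be a family of elements of $\mathbb{K}$ such that the double series $\sum_{i,j}a_{ij}$ converges. Assume that $\mathbb{N}^2$ is partitioned into a finite or countable number of disjoint subsets $J_0,J_1,J_2,\dots$, each finite or countable. Then $$\sum_{i,j} a_{ij}=\sum_{r}\Bigl(\sum_{(h,k)\in J_r} a_{hk}\Bigr),$$ where the outer sum runs over all indices $r=0,1,2,\dots$ of the partition (it is a finite sum if the partition is finite, and a convergent series $\sum_{r=0}^\infty$ otherwise).
   Context: $\mathbb{K}$ is a non-Archimedean ordered field (i.e. it contains an element larger than every integer), equipped with its order topology, which is (Cauchy) complete and has a countable basis of neighbourhoods of $0$. $\mathbb{N}=\{0,1,2,\dots\}$. A series $\sum_n c_n=\sum_{n=0}^\infty c_n$ in $\mathbb{K}$ converges to $c$ if its sequence of partial sums converges to $c$. A double series $\sum_{i,j}a_{ij}$ over $(i,j)\in\mathbb{N}^2$ is said to converge if, for a bijection $k\mapsto(\phi(k),\psi(k))$ from $\mathbb{N}$ to $\mathbb{N}^2$, the ordinary series $\sum_k a_{\phi(k),\psi(k)}$ converges; its sum is then by definition the sum of this ordinary series (convergence and sum do not depend on the chosen bijection). For a convergent double series $\sum_{i,j}a_{ij}$ and a subset $J\subseteq\mathbb{N}^2$, the restricted sum is defined by $\sum_{(i,j)\in J}a_{ij}=\sum_{i,j}b_{ij}$, where $b_{ij}=a_{ij}$ if $(i,j)\in J$ and $b_{ij}=0$ if $(i,j)\notin J$ (this double series converges because $|b_{ij}|\le|a_{ij}|$).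 *)

(* Defs.v *)
From HB Require Import structures.
From mathcomp Require Import all_boot all_order all_algebra.
From mathcomp Require Import all_classical all_reals all_analysis.

Set Implicit Arguments.
Unset Strict Implicit.
Unset Printing Implicit Defensive.

Import Order.TTheory GRing.Theory Num.Theory.
Import numFieldNormedType.Exports.

Local Open Scope classical_set_scope.
Local Open Scope ring_scope.

(* The canonical topology of K : realFieldType is the order topology: K is
   canonically an orderTopologicalType, see the library lemma itv_nbhsE. *)

Definition non_archimedean (K : realFieldType) : Prop :=
  exists w : K, forall z : int, z%:~R < w.

Definition cauchy_complete (K : realFieldType) : Prop :=
  forall u : nat -> K, cauchy (u @ \oo) -> cvg (u @ \oo).

Definition countable_nbhs_basis0 (K : realFieldType) : Prop :=
  exists B : set (set K),
    [/\ countable B,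
        (forall U, B U -> nbhs (0 : K) U)
      & (forall V, nbhs (0 : K) V -> exists2 U, B U & U `<=` V)].

(* Sums are relations rather than functions, so that no bijection of N onto N^2
   has to be singled out. *)
Definition double_series_to (K : realFieldType) (a : nat * nat -> K) (s : K)
    : Prop :=
  exists2 phi : nat -> nat * nat,
    bijective phi & series (fun k => a (phi k)) @ \oo --> s.

Definition restricted_sum_to (K : realFieldType) (a : nat * nat -> K)
    (J : set (nat * nat)) (t : K) : Prop :=
  double_series_to (patch (fun=> 0) J a) t.

(* Unlike the library's partition, blocks may be empty; countable means finite
   or countably infinite. *)
Definition partitions_N2 (I : Type) (J : I -> set (nat * nat)) : Prop :=
  [/\ cover [set: I] J = [set: nat * nat],
      trivIset [set: I] J
    & forall r, countable (J r)].

(* Main.v *)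
(* Dividing by an infinitely large element turns any e > 0 into a d > 0 all of
   whose multiples stay below e, so finite sums of arbitrarily many terms below
   d are below e.  Hence terms tending to 0 force partial sums to be Cauchy
   (which gives the restricted sums), and a convergent double series is the
   limit of the net of its sums over finite sets of indices.  In that form the
   sum is finitely additive, and the sum over J_0, ..., J_(n-1) is close to the
   total one as soon as these blocks cover a large enough finite set. *)
Require Import Defs.
From HB Require Import structures.
From mathcomp Require Import all_boot all_order all_algebra.
From mathcomp Require Import all_classical all_reals all_analysis.
Set Implicit Arguments.
Unset Strict Implicit.

Import Order.TTheory GRing.Theory Num.Theory.
Import numFieldNormedType.Exports.
Local Open Scope classical_set_scope.
Local Open Scope ring_scope.

(** Limit of the net of finite sums, the finite sets being directed by inclusion. Only [G] has to be
    duplicate-free, so [F] can be any concatenation of sequences. *)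
Definition unconditional_sum (K : realFieldType) (T : eqType) (a : T -> K)
    (s : K) : Prop :=
  forall e : K, 0 < e -> exists F : seq T, forall G : seq T,
    uniq G -> {subset F <= G} -> `|s - \sum_(p <- G) a p| < e.

Lemma unconditional_sum0 (K : realFieldType) (T : eqType) :
  unconditional_sum (fun _ : T => 0 : K) 0.
Proof.
by move=> e e0; exists [::] => G _ _; rewrite big1// subrr normr0.
Qed.

Lemma unconditional_sumD (K : realFieldType) (T : eqType) (a b : T -> K)
    (s t : K) : unconditional_sum a s -> unconditional_sum b t ->
  unconditional_sum (fun p => a p + b p) (s + t).
Proof.
move=> a_s b_t e e0; have e20 : 0 < e / 2 by rewrite divr_gt0.
have [[F aF] [F' bF']] := (a_s _ e20, b_t _ e20).
exists (F ++ F') => G uG sub_G; rewrite big_split opprD addrACA [e]splitr.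
rewrite (le_lt_trans (ler_normD _ _))// ltrD ?aF ?bF'// => p pF;
  by rewrite sub_G// mem_cat pF ?orbT.
Qed.

Lemma unconditional_sum_big (K : realFieldType) (T : eqType) (I : Type)
    (r : seq I) (a : I -> T -> K) (t : I -> K) :
    (forall i, unconditional_sum (a i) (t i)) ->
  unconditional_sum (fun p => \sum_(i <- r) a i p) (\sum_(i <- r) t i).
Proof.
move=> a_t; elim: r => [|i r IHr].
  rewrite big_nil; under eq_fun do rewrite big_nil; exact: unconditional_sum0.
rewrite big_cons; under eq_fun do rewrite big_cons.
exact: unconditional_sumD.
Qed.

(** The sum of the patched family over a finite [G] is the sum of [a] over the part of [G] in [U],
    which still contains [F]. So [F] is chosen before [U] and serves every [U] at once. *)
Lemma unconditional_sum_patch_dist (K : realFieldType) (T : eqType)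
    (a : T -> K) (s e : K) : unconditional_sum a s -> 0 < e ->
  exists F : seq T, forall (U : set T) (u : K), [set` F] `<=` U ->
    unconditional_sum (patch (fun=> 0) U a) u -> `|s - u| < e.
Proof.
move=> a_s e0; have e20 : 0 < e / 2 by rewrite divr_gt0.
have [F aF] := a_s _ e20; exists F => U u FU /(_ _ e20)[F' aF'].
pose G := undup (F ++ F'); pose H := [seq p <- G | p \in U].
have sumE : \sum_(p <- G) patch (fun=> 0) U a p = \sum_(p <- H) a p.
  by rewrite big_filter [RHS]big_mkcond.
rewrite -(subrKA (\sum_(p <- H) a p)) [e]splitr.
rewrite (le_lt_trans (ler_normD _ _))// ltrD//.
  rewrite aF ?filter_uniq ?undup_uniq// => p pF.
  by rewrite mem_filter mem_undup mem_cat pF andbT inE; exact: FU.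
rewrite distrC -sumE aF' ?undup_uniq// => p pF'.
by rewrite mem_undup mem_cat pF' orbT.
Qed.

Lemma unconditional_sum_unique (K : realFieldType) (T : eqType)
    (a : T -> K) (s t : K) :
  unconditional_sum a s -> unconditional_sum a t -> s = t.
Proof.
move=> a_s a_t; apply/eqP; rewrite -subr_eq0 -normr_le0.
apply/ler_addgt0Pl => e e0; rewrite addr0 ltW//.
have [F FP] := unconditional_sum_patch_dist a_s e0.
by apply: (FP setT) => //; rewrite patch_setT.
Qed.

Lemma sum_patch_bigcup (V : nmodType) (T : Type) (I : choiceType)
    (J : I -> set T) (r : seq I) (a : T -> V) (p : T) :
    trivIset setT J -> uniq r ->
  \sum_(i <- r) patch (fun=> 0) (J i) a p =
  patch (fun=> 0) (\bigcup_(i in [set` r]) J i) a p.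
Proof.
move=> tJ ur; rewrite [RHS]/patch; case: ifPn => [|pU].
  rewrite inE => -[i /= ir Jip]; rewrite (big_rem i)//= patchT ?inE//.
  rewrite big_seq big1 ?addr0// => j; rewrite mem_rem_uniq// inE => /andP[ji _].
  rewrite patchN// inE; apply: contra ji => /set_mem Jjp; apply/eqP.
  by apply: tJ => //; exists p.
rewrite big_seq big1// => i ir; rewrite patchN// inE.
by apply: contra pU => /set_mem Jip; rewrite inE; exists i.
Qed.

Lemma nonarchimedean_small_sums (K : realFieldType) (e : K) :
    non_archimedean K -> 0 < e ->
  exists2 d : K, 0 < d & forall (I : eqType) (r : seq I) (f : I -> K),
    {in r, forall i, `|f i| < d} -> `|\sum_(i <- r) f i| < e.
Proof.
move=> [w w_gt] e0; have w0 : 0 < w := w_gt 0.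
(* As [w] exceeds [size r], that many copies of [e / w] stay below [e], whatever the length of
   [r]. *)
exists (e / w) => [|I r f f_lt]; first by rewrite divr_gt0.
apply: (@le_lt_trans _ _ (e / w *+ size r)).
  rewrite (le_trans (ler_norm_sum _ _ _))// big_seq_cond.
  rewrite (le_trans (ler_sum _ (G := fun=> e / w) _))// => [i|].
    by rewrite andbT => /f_lt/ltW.
  by rewrite -big_seq_cond big_const_seq count_predT iter_addr_0.
rewrite -mulr_natr mulrAC ltr_pdivrMr// ltr_pM2l//.
by have := w_gt (size r); rewrite -pmulrn.
Qed.

(** Arbitrary sequences of late indices are allowed, not just intervals: rearranging a series leaves
    scattered indices. *)
Lemma nonarchimedean_tail_sums (K : realFieldType) (u : nat -> K) (e : K) :
    non_archimedean K -> u @ \oo --> 0 -> 0 < e ->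
  exists N : nat, forall r : seq nat, {in r, forall k, (N <= k)%N} ->
    `|\sum_(k <- r) u k| < e.
Proof.
move=> Kna u0 e0; have [d d0 dP] := nonarchimedean_small_sums Kna e0.
have /cvgr0Pnorm_lt/(_ _ d0)[N _ uN] := u0.
by exists N => r rN; apply: dP => k /rN /uN.
Qed.

Lemma nonarchimedean_cvg_series (K : realFieldType) (u : nat -> K) :
    non_archimedean K -> cauchy_complete K -> u @ \oo --> 0 ->
  cvg (series u @ \oo).
Proof.
move=> Kna Kc u0; apply: Kc; apply/cauchy_seriesP => e e0.
have [N uN] := nonarchimedean_tail_sums Kna u0 e0.
(* Only the lower bound of the interval of summation needs to be large. *)
exists ([set n | (N <= n)%N], setT) => /=.
  by split; [exists N|exact: filterT].
move=> [m n] /= [Nm _]; apply: uN => k; rewrite mem_index_iota => /andP[mk _].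
exact: leq_trans mk.
Qed.

Lemma double_series_unconditional_sum (K : realFieldType)
    (a : nat * nat -> K) (s : K) : non_archimedean K ->
  double_series_to a s -> unconditional_sum a s.
Proof.
move=> Kna [phi [psi phiK psiK] a_s] e e0.
have e20 : 0 < e / 2 by rewrite divr_gt0.
have a0 : (fun k => a (phi k)) @ \oo --> 0.
  by apply: cvg_series_cvg_0; apply/cvg_ex; exists s.
have [N aN] := nonarchimedean_tail_sums Kna a0 e20.
have /cvgrPdist_lt/(_ _ e20)[M _ sM] := a_s.
(* [M] brings the partial sum close to [s], and [N] makes the remaining terms of [G] negligible. *)
pose n := maxn M N; exists [seq phi k | k <- iota 0 n] => G uG sub_G.
pose H := [seq psi p | p <- G].
have -> : \sum_(p <- G) a p = \sum_(k <- H) a (phi k).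
  by rewrite big_map; apply: eq_bigr => p _; rewrite psiK.
have uH : uniq H by rewrite map_inj_uniq//; exact: can_inj psiK.
have sub_H : {subset iota 0 n <= H}.
  move=> k kn; rewrite -(phiK k) map_f// sub_G//.
  exact: (map_f phi).
(* The indices of [H] below [n] are exactly those of the [n]-th partial sum; the others lie beyond
   [N]. *)
rewrite (bigID (fun k => k < n)%N)/=.
rewrite -[X in _ - (X + _)]big_filter -[X in _ - (_ + X)]big_filter.
rewrite (perm_big (index_iota 0 n)); last first.
  apply: uniq_perm; rewrite ?filter_uniq ?iota_uniq// => k.
  rewrite mem_filter mem_index_iota /=; case: ltnP => //= kn.
  by rewrite sub_H// mem_iota.
rewrite opprD addrA [e]splitr (le_lt_trans (ler_normB _ _))//.
rewrite ltrD//; first by apply: sM; exact: leq_maxl.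
apply: aN => k; rewrite mem_filter -leqNgt => /andP[nk _].
exact: leq_trans (leq_maxr _ _) nk.
Qed.

(** Along the same [phi], replacing terms by 0 keeps them tending to 0, which suffices for
    convergence here. *)
Lemma restricted_sum_exists (K : realFieldType) (a : nat * nat -> K) (s : K)
    (J : set (nat * nat)) : non_archimedean K -> cauchy_complete K ->
  double_series_to a s -> exists t : K, restricted_sum_to a J t.
Proof.
move=> Kna Kc [phi phi_bij a_s].
have /cvgr0Pnorm_lt a0 : (fun k => a (phi k)) @ \oo --> 0.
  by apply: cvg_series_cvg_0; apply/cvg_ex; exists s.
suff /(nonarchimedean_cvg_series Kna Kc)/cvg_ex[t tP] :
  (fun k => patch (fun=> 0) J a (phi k)) @ \oo --> 0 by exists t, phi.
apply/cvgr0Pnorm_lt => e e0; apply: filterS (a0 _ e0) => k ak.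
by rewrite /patch; case: ifP => //; rewrite normr0.
Qed.

Theorem theorem5p1 (K : realFieldType)
    (K_nonarch : non_archimedean K)
    (K_complete : cauchy_complete K)
    (K_basis : countable_nbhs_basis0 K)
    (a : nat * nat -> K) (s : K) (a_s : double_series_to a s) :
  (forall (m : nat) (J : 'I_m -> set (nat * nat)), partitions_N2 J ->
     (forall r, exists t : K, restricted_sum_to a (J r) t) /\
     (forall t : 'I_m -> K, (forall r, restricted_sum_to a (J r) (t r)) ->
        s = \sum_(r < m) t r)) /\
  (forall J : nat -> set (nat * nat), partitions_N2 J ->
     (forall r, exists t : K, restricted_sum_to a (J r) t) /\
     (forall t : nat -> K, (forall r, restricted_sum_to a (J r) (t r)) ->
        series t @ \oo --> s)).
Proof.
have sum_a := double_series_unconditional_sum K_nonarch a_s.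
have sum_blocks (I : choiceType) (J : I -> set (nat * nat)) (t : I -> K) r :
    trivIset setT J -> uniq r -> (forall i, restricted_sum_to a (J i) (t i)) ->
    unconditional_sum (patch (fun=> 0) (\bigcup_(i in [set` r]) J i) a)
                      (\sum_(i <- r) t i).
  move=> tJ ur tP; rewrite -(funext (fun p => sum_patch_bigcup a p tJ ur)).
  apply: unconditional_sum_big => i.
  exact: double_series_unconditional_sum (tP i).
split=> [m J|J] [cJ tJ _];
  (split=> [r|t tP]; first exact: restricted_sum_exists a_s).
  (* All the blocks together cover the whole index set, so the sum of the [t r] is a sum of [a]
     itself. *)
  apply: (unconditional_sum_unique sum_a).
  have := sum_blocks _ _ _ _ tJ (index_enum_uniq _) tP.
  rewrite (_ : [set` _] = setT).
    by rewrite [\bigcup_(i in _) _]cJ patch_setT.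
  by apply/seteqP; split=> // i _ /=; rewrite mem_index_enum.
apply/cvgrPdist_lt => e e0.
have [F FP] := unconditional_sum_patch_dist sum_a e0.
have blockP p : exists i, J i p.
  by have : setT p by []; rewrite -cJ => -[i _]; exists i.
pose block p := projT1 (cid (blockP p)).
(* [series t n] stops at block [n - 1], hence the successor: from here on the first [n] blocks cover
   [F]. *)
exists (\max_(p <- F) (block p).+1)%N => // n /= F_n.
apply: FP (sum_blocks _ _ _ _ tJ (iota_uniq 0 _) tP) => p /= pF.
exists (block p); last exact: (projT2 (cid (blockP p))).
rewrite /= mem_index_iota /= (leq_trans _ F_n)//.
exact: (bigmaxn_sup_seq p).
Qed.
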